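(* Let $\mathcal{G}$ be an undirected connected graph on $\mathcal{V}=\{1,\dots,N\}$, let $\delta_1^*,\dots,\delta_N^*\in\mathbb{R}^2$ be the desired formation offsets, and for each $i\in\mathcal{V}$ let the constants satisfy $\gamma_i>0$, $0<k_{1i}<1$, $k_{2i}=1-k_{1i}^2$. Consider, for $i\in\mathcal{V}$, the designed dynamics $$\begin{aligned}\dot Q_i(t)&=-\big(Q_i(t)-\hat\eta_i(t)-\delta_i^*\big),\\ \dot{\hat\eta}_i(t)&=-\gamma_i\sum_{j\in\mathcal{N}_i}(\hat\eta_i(t)-\hat\eta_j(t))+\big(Q_i(t)-\hat\eta_i(t)-\delta_i^*\big)-k_{1i}\omega_i(t),\\ \dot\omega_i(t)&=k_{1i}\Big(\gamma_i\sum_{j\in\mathcal{N}_i}(\hat\eta_i(t)-\hat\eta_j(t))-\big(Q_i(t)-\hat\eta_i(t)-\delta_i^*\big)\Big)-k_{2i}\omega_i(t),\end{aligned}$$ with states $Q_i(t),\hat\eta_i(t),\omega_i(t)\in\mathbb{R}^2$, and write $X(t)=\mathrm{col}(Q(t),\hat\eta(t),\omega(t))\in\mathbb{R}^{6N}$ for the stacked state. Then for any initial condition $X(0)=\mathrm{col}(Q(0),\hat\eta(0),\omega(0))\in\mathbb{R}^{6N}$, the trajectory $X(t)$ converges at an exponential rate to a steady state $X^*=\mathrm{col}(Q^*,\hat\eta^*,\omega^* )$ (an equilibrium of the dynamics, which may depend on $X(0)$). Furthermore, this steady state is an optimal solution of the formation problem $$\min_{Q_i\in\mathbb{R}^2}V_i(Q_i,Q_{ave}),\qquad\forall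 i\in\mathcal{V},$$ i.e., for every $i\in\mathcal{V}$, $Q_i^*$ minimizes $V_i(Q_i,Q_{ave})$ over $Q_i\in\mathbb{R}^2$ when the other positions are fixed at $Q_j=Q_j^*$, $j\neq i$.
   Context: The graph $\mathcal{G}$ has 0/1 symmetric adjacency matrix without self-loops; $\mathcal{N}_i$ denotes the set of neighbors of node $i$. $\mathrm{col}(\cdot)$ denotes stacking into a column vector, with $Q=\mathrm{col}(Q_1,\dots,Q_N)$, $\hat\eta=\mathrm{col}(\hat\eta_1,\dots,\hat\eta_N)$, $\omega=\mathrm{col}(\omega_1,\dots,\omega_N)$, all in $\mathbb{R}^{2N}$. Formation offsets: given desired positions $\bar Q_1,\dots,\bar Q_N\in\mathbb{R}^2$, the offsets are $\delta_i^*=\bar Q_i-\frac1N\sum_{j=1}^N\bar Q_j$, equivalently $\delta_i^*=\frac1N\sum_{j=1}^N\delta_{ij}^*$ with $\delta_{ij}^*=\bar Q_i-\bar Q_j$; in particular $\sum_{i=1}^N\delta_i^*=0$. Cost functions: $V_i(Q_i,Q_{ave})=\frac12\Vert Q_i-Q_{ave}-\delta_i^*\Vert^2$, where $Q_{ave}=\frac1N\sum_{j=1}^NQ_j$ is the centroid of the positions and $\Vert\cdot\Vert$ is the Euclidean norm. Convergence at an exponential rate means that there exist constants $c\ge 0$ and $\lambda>0$ (with $c$ possibly depending on $X(0)$) such that $\Vert X(t)-X^*\Vert\le c\,e^{-\lambda t}$ for all $t\ge0$. *)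

(* Defs.v *)
From HB Require Import structures.
From mathcomp Require Import all_boot all_order all_algebra.
From mathcomp Require Import all_classical all_reals all_analysis.
Set Implicit Arguments.
Unset Strict Implicit.
Unset Printing Implicit Defensive.
Import Order.TTheory GRing.Theory Num.Theory.
Import numFieldNormedType.Exports.
Local Open Scope classical_set_scope.
Local Open Scope ring_scope.

(* A family (v_1, ..., v_N) of planar vectors is the N x 2 matrix with i-th
   row v_i, and X = col(Q, eta, omega) is the vertical concatenation of three
   such matrices: its 6N entries are the coordinates of the stacked vector. *)
Definition state (R : realType) (N : nat) := 'M[R]_(N + (N + N), 2).

Definition pos (R : realType) (N : nat) (X : state R N) : 'M[R]_(N, 2) :=
  usubmx X.

Definition est (R : realType) (N : nat) (X : state R N) : 'M[R]_(N, 2) :=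
  usubmx (dsubmx X).

Definition aux (R : realType) (N : nat) (X : state R N) : 'M[R]_(N, 2) :=
  dsubmx (dsubmx X).

(* The library norm on matrices is the max norm. This is the Euclidean norm of
   the vector of all entries. *)
Definition enorm (R : realType) (m n : nat) (A : 'M[R]_(m, n)) : R :=
  Num.sqrt (\sum_i \sum_j A i j ^+ 2).

Definition centroid (R : realType) (N : nat) (Q : 'M[R]_(N, 2)) : 'rV[R]_2 :=
  N%:R^-1 *: \sum_(j < N) row j Q.

Definition offset (R : realType) (N : nat) (Qbar : 'M[R]_(N, 2)) (i : 'I_N) :
    'rV[R]_2 :=
  row i Qbar - centroid Qbar.

Definition simple_graph (N : nat) (adj : rel 'I_N) : Prop :=
  symmetric adj /\ irreflexive adj.

Definition connected_graph (N : nat) (adj : rel 'I_N) : Prop :=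
  forall i j : 'I_N, connect adj i j.

Definition disagreement (R : realType) (N : nat) (adj : rel 'I_N)
    (X : state R N) (i : 'I_N) : 'rV[R]_2 :=
  \sum_(j < N | adj i j) (row i (est X) - row j (est X)).

Definition tracking_error (R : realType) (N : nat) (delta : 'I_N -> 'rV[R]_2)
    (X : state R N) (i : 'I_N) : 'rV[R]_2 :=
  row i (pos X) - row i (est X) - delta i.

Definition dynamics (R : realType) (N : nat) (adj : rel 'I_N)
    (delta : 'I_N -> 'rV[R]_2) (gamma k1 k2 : 'I_N -> R) (X : state R N) :
    state R N :=
  let L := disagreement adj X in
  let e := tracking_error delta X in
  let w i := row i (aux X) in
  col_mx (\matrix_(i < N) - e i)
    (col_mx (\matrix_(i < N) (- (gamma i *: L i) + e i - k1 i *: w i))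
       (\matrix_(i < N) (k1 i *: (gamma i *: L i - e i) - k2 i *: w i))).

(* Solutions on [0, +oo[ in the classical sense: only the values X t with
   0 <= t matter, and the one-sided equation at t = 0 follows from continuity. *)
Definition trajectory (R : realType) (N : nat) (F : state R N -> state R N)
    (X : R -> state R N) : Prop :=
  {within `[0, +oo[, continuous X} /\
  forall t : R, 0 < t -> is_derive t 1 X (F (X t)).

Definition equilibrium (R : realType) (N : nat) (F : state R N -> state R N)
    (X : state R N) : Prop :=
  F X = 0.

Definition cost (R : realType) (deltai qi qave : 'rV[R]_2) : R :=
  2^-1 * enorm (qi - qave - deltai) ^+ 2.

Definition move_agent (R : realType) (N : nat) (Q : 'M[R]_(N, 2)) (i : 'I_N)
    (q : 'rV[R]_2) : 'M[R]_(N, 2) :=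
  \matrix_(j < N) (if j == i then q else row j Q).

(* The centroid is itself affected when agent i moves. *)
Definition formation_optimal (R : realType) (N : nat)
    (delta : 'I_N -> 'rV[R]_2) (Q : 'M[R]_(N, 2)) : Prop :=
  forall (i : 'I_N) (q : 'rV[R]_2),
    cost (delta i) (row i Q) (centroid Q) <=
    cost (delta i) q (centroid (move_agent Q i q)).

(* Main.v *)
Require Import Defs.
From HB Require Import structures.
From mathcomp Require Import all_boot all_order all_algebra.
From mathcomp Require Import all_classical all_reals all_analysis.
From mathcomp Require Import ring lra.
Set Implicit Arguments.
Unset Strict Implicit.
Unset Printing Implicit Defensive.
Import Order.TTheory GRing.Theory Num.Theory.
Import numFieldNormedType.Exports.
Local Open Scope classical_set_scope.
Local Open Scope ring_scope.

(* Write e = Q - eta - delta and g = gamma * (L eta) - e, with L the graph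
   Laplacian, for the deviation from an equilibrium. The function
   V = (<eta, L eta> + sum (|e|^2 + |omega|^2) / gamma) / 2 satisfies
   V' = - D with D = sum (|g|^2 + |e|^2 + k2 |omega|^2) / gamma. Since
   L eta = (g + e) / gamma, the Poincare inequality of the connected graph gives
   V <= C D, hence exponential decay of V. V controls the deviation only up to consensus; because of
   k2 = 1 - k1^2 the quantity sum (Q + k2 eta - k1 omega) / gamma is conserved,
   and it selects the equilibrium for which the consensus part of the deviation
   vanishes. Solutions exist as power series of the linear part. *)

(** * Linear differential equations *)

Section LinearODE.
Context {R : realType}.

Lemma is_derive_mxP {m n : nat} (M : R -> 'M[R]_(m, n)) (t : R) (A : 'M[R]_(m, n)) :
  is_derive t 1 M A <-> forall i j, is_derive t 1 (fun s => M s i j) (A i j).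
Proof.
split=> [[dM <-] i j|dM].
  have dMij := (derivable_mxP M t 1).1 dM.
  by apply: DeriveDef; [exact: dMij|rewrite (derive_mx dM) mxE].
have dM' : derivable M t 1.
  by apply/derivable_mxP => i j; have [] := dM i j.
apply: DeriveDef => //; rewrite (derive_mx dM').
by apply/matrixP => i j; rewrite mxE; have [_] := dM i j.
Qed.

Lemma ler_mx_entry {m n : nat} (A : 'M[R]_(m, n)) i j : `|A i j| <= `|A|.
Proof.
by rewrite {2}/Num.Def.normr/= mx_normrE; exact: (le_bigmax _ _ (i, j)).
Qed.

Lemma linear_mx_entry {m n p q : nat} (f : {linear 'M[R]_(m, n) -> 'M[R]_(p, q)})
    (A : 'M[R]_(m, n)) i j :
  f A i j = \sum_a \sum_b A a b * f (delta_mx a b) i j.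
Proof.
rewrite {1}(matrix_sum_delta A) linear_sum summxE; apply: eq_bigr => a _.
by rewrite linear_sum summxE; apply: eq_bigr => b _; rewrite linearZ/= mxE.
Qed.

Lemma linear_mx_bounded {m n p q : nat}
    (f : {linear 'M[R]_(m, n) -> 'M[R]_(p, q)}) :
  exists2 K, 0 <= K & forall A, `|f A| <= K * `|A|.
Proof.
exists (\sum_a \sum_b `|f (delta_mx a b)|).
  by apply: sumr_ge0 => a _; apply: sumr_ge0.
move=> A; rewrite {1}(matrix_sum_delta A) linear_sum mulr_suml.
apply: le_trans (ler_norm_sum _ _ _) _; apply: ler_sum => a _.
rewrite linear_sum mulr_suml.
apply: le_trans (ler_norm_sum _ _ _) _; apply: ler_sum => b _.
by rewrite linearZ/= normrZ mulrC ler_wpM2l// ler_mx_entry.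
Qed.

(** The solution is the exponential of [t f] applied to [X0], built entry by entry as a scalar power
    series. A bound [K] on [f] makes every such series dominated by the series of exp(K|t|). *)
Lemma linear_ode_solution {m n : nat} (f : {linear 'M[R]_(m, n) -> 'M[R]_(m, n)})
    (X0 : 'M[R]_(m, n)) :
  exists X : R -> 'M[R]_(m, n),
    X 0 = X0 /\ forall t : R, is_derive t 1 X (f (X t)).
Proof.
have [K K0 fK] := linear_mx_bounded f.
pose c (Y : 'M[R]_(m, n)) i j k := (iter k f Y) i j / k`!%:R.
have iter_le Y k : `|iter k f Y| <= K ^+ k * `|Y|.
  elim: k => [|k IH] /=; first by rewrite expr0 mul1r.
  by rewrite exprS -mulrA; apply: le_trans (fK _) _; exact: ler_wpM2l.
have cvg_c Y i j t : cvgn (pseries (c Y i j) t).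
  apply: normed_cvg; rewrite /normed_series_of/=.
  apply: (@series_le_cvg _ _ (`|Y| *: exp_coeff (K * `|t|))) => /=.
  - by move=> k.
  - by move=> k; rewrite mulr_ge0// exp_coeff_ge0 ?mulr_ge0.
  - move=> k; rewrite /c /exp_coeff [leRHS]/= !normrM normfV normr_nat normrX.
    apply: (@le_trans _ _ ((K ^+ k * `|Y|) / k`!%:R * `|t| ^+ k)).
      rewrite !ler_wpM2r ?invr_ge0 ?exprn_ge0//.
      exact: le_trans (ler_mx_entry _ _ _) (iter_le _ _).
    rewrite /= [X in _ <= X]/GRing.scale/= exprMn le_eqVlt; apply/orP; left.
    by apply/eqP; transitivity (`|Y| * (K ^+ k * `|t| ^+ k / k`!%:R)) => //; ring.
  - exact/is_cvg_seriesZ/is_cvg_series_exp_coeff.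
(* Formal differentiation replaces [Y] by [f Y], since the factor k + 1 cancels in (k + 1)!; hence
   [cvg_c] also covers all differentiated series. *)
have diffs_c Y i j : pseries_diffs (c Y i j) = c (f Y) i j.
  apply/funext => k; rewrite /pseries_diffs /c iterSr factS natrM.
  by rewrite invfM mulrCA mulVKf// pnatr_eq0.
exists (fun t => \matrix_(i, j) limn (pseries (c X0 i j) t)); split.
  apply/matrixP => i j; rewrite mxE; apply/cvg_lim => //.
  (* The partial sum of index 0 is empty; all later ones equal [X0 i j], as 0^0 = 1. *)
  rewrite -cvg_shiftS/= (_ : (fun _ => _) = cst (X0 i j)); first exact: cvg_cst.
  apply/funext => k; rewrite /pseries /series/= big_nat_recl//= big1 => [|p _].
    by rewrite /c/= expr0 fact0 divr1 mulr1 addr0.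
  by rewrite expr0n mulr0.
move=> t; apply/is_derive_mxP => i j.
rewrite (_ : (fun _ => _) = fun s => limn (pseries (c X0 i j) s)); last first.
  by apply/funext => s; rewrite mxE.
rewrite (_ : f _ i j = limn (pseries (pseries_diffs (c X0 i j)) t)).
  (* Termwise differentiation at [t] requires convergence at a point of larger modulus. *)
  apply: (@pseries_snd_diffs _ _ (`|t| + 1)); rewrite ?diffs_c//.
  by rewrite [ltRHS]ger0_norm ?ltrDl// addr_ge0.
rewrite diffs_c; apply/esym/cvg_lim => //.
(* Expanding over the basis matrices turns the series for [f X0] into a finite combination of series
   for [X0], so [f] passes through the limit. *)
rewrite linear_mx_entry (_ : pseries _ t = fun k =>
    \sum_a \sum_b pseries (c X0 a b) t k * f (delta_mx a b) i j); last first.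
  apply/funext => k; rewrite /pseries /series/=.
  under eq_bigr => p _.
    rewrite /c -iterSr /= linear_mx_entry !mulr_suml.
    under eq_bigr => a _ do rewrite !mulr_suml.
    over.
  rewrite exchange_big; apply: eq_bigr => a _.
  rewrite exchange_big; apply: eq_bigr => b _.
  by rewrite mulr_suml; apply: eq_bigr => p _; rewrite -!mulrA; congr (_ * _); ring.
apply: (cvg_big add_continuous) => a _; apply: (cvg_big add_continuous) => b _.
by rewrite mxE; apply: cvgMr_tmp; exact: cvg_c.
Qed.

End LinearODE.

(** * Quadratic domination *)

Section Domination.
Context {R : realType} {T : Type}.
Implicit Types (V y z : T -> R).

(** The constant is uniform in [s] but stays existential, so that linear combinations can be bounded
    without tracking explicit constants. *)
Definition dominated V y := exists2 C, 0 <= C & forall s, y s ^+ 2 <= C * V s.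

Lemma dominatedD V y z :
  dominated V y -> dominated V z -> dominated V (fun s => y s + z s).
Proof.
move=> [C C0 yC] [D D0 zD]; exists (2 * (C + D)) => [|s].
  by rewrite mulr_ge0 ?addr_ge0.
have := yC s; have := zD s; have := sqr_ge0 (y s - z s); lra.
Qed.

Lemma dominatedZ V a y : dominated V y -> dominated V (fun s => a * y s).
Proof.
move=> [C C0 yC]; exists (a ^+ 2 * C) => [|s].
  by rewrite mulr_ge0 ?sqr_ge0.
by rewrite exprMn -[leRHS]mulrA ler_wpM2l ?sqr_ge0.
Qed.

Lemma dominated_sum V (I : finType) (y : I -> T -> R) :
  (forall i, dominated V (y i)) -> dominated V (fun s => \sum_i y i s).
Proof.
move=> dom_y; elim: (index_enum I) => [|i r IH].
  by exists 0 => // s; rewrite big_nil expr0n mul0r.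
under eq_fun do rewrite big_cons; exact: dominatedD.
Qed.

Lemma dominated_le V W K y : 0 <= K -> (forall s, V s <= K * W s) ->
  dominated V y -> dominated W y.
Proof.
move=> K0 VW [C C0 yC]; exists (C * K) => [|s]; first exact: mulr_ge0.
by apply: le_trans (yC s) _; rewrite -mulrA ler_wpM2l.
Qed.

Lemma dominated_sum_sqr V (I : finType) (w : I -> R) (y : I -> T -> R) :
  (forall i, 0 <= w i) -> (forall i, dominated V (y i)) ->
  exists2 C, 0 <= C & forall s, \sum_i w i * y i s ^+ 2 <= C * V s.
Proof.
move=> w0 dom_y; elim: (index_enum I) => [|i r [C C0 IH]].
  by exists 0 => // s; rewrite big_nil mul0r.
have [D D0 yD] := dom_y i; exists (w i * D + C) => [|s].
  by rewrite addr_ge0// mulr_ge0.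
by rewrite big_cons mulrDl lerD// -mulrA ler_wpM2l.
Qed.

End Domination.

(** * Graph Laplacian *)

Section Laplacian.
Context {R : realType} {N : nat} (adj : rel 'I_N).
Hypothesis adj_sym : symmetric adj.
Implicit Types x y : 'I_N -> R.

Definition laplacian x i := \sum_(j | adj i j) (x i - x j).

(** For symmetric [adj] this is the sum of the squared differences over the edges. *)
Definition dirichlet x := \sum_i x i * laplacian x i.

(** Exchanging the roles of [i] and [j], which symmetry of [adj] allows, gives a second expression
    of the same sum; the two are added. *)
Lemma laplacian_form x y :
  2 * (\sum_i y i * laplacian x i) =
  \sum_i \sum_(j | adj i j) (y i - y j) * (x i - x j).
Proof.
have E : \sum_i y i * laplacian x i = \sum_i \sum_(j | adj i j) y i * (x i - x j).
  by apply: eq_bigr => i _; rewrite mulr_sumr.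
have E' : \sum_i y i * laplacian x i = \sum_i \sum_(j | adj i j) y j * (x j - x i).
  rewrite E (exchange_big_dep predT)//=; apply: eq_bigr => i _.
  by apply: eq_bigl => j; rewrite adj_sym.
rewrite mulr2n mulrDl mul1r {1}E E' -big_split; apply: eq_bigr => i _ /=.
by rewrite -big_split; apply: eq_bigr => j _ /=; ring.
Qed.

Lemma laplacian_sym x y :
  \sum_i y i * laplacian x i = \sum_i x i * laplacian y i.
Proof.
apply: (@mulfI _ 2); rewrite ?pnatr_eq0// !laplacian_form.
by apply: eq_bigr => i _; apply: eq_bigr => j _; rewrite mulrC.
Qed.

Lemma dirichlet_ge0 x : 0 <= dirichlet x.
Proof.
rewrite -(pmulr_rge0 _ (ltr0n R 2)) laplacian_form.
by apply: sumr_ge0 => i _; apply: sumr_ge0 => j _; rewrite -expr2 sqr_ge0.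
Qed.

(** The square is one of the nonnegative terms in the double sum for twice [dirichlet]. *)
Lemma dominated_edge i j : adj i j -> dominated dirichlet (fun x => x i - x j).
Proof.
move=> aij; exists 2 => // x; rewrite laplacian_form.
rewrite (bigD1 i)//= (bigD1 j)//= -expr2 -addrA lerDl addr_ge0//.
  by apply: sumr_ge0 => k _; rewrite -expr2 sqr_ge0.
by apply: sumr_ge0 => k _; apply: sumr_ge0 => l _; rewrite -expr2 sqr_ge0.
Qed.

Hypothesis adj_conn : connected_graph adj.

(** The difference telescopes along a path from [i] to [j], and each edge is dominated. *)
Lemma poincare i j : dominated dirichlet (fun x => x i - x j).
Proof.
have /connectP[p] := adj_conn i j; elim: p i => [|k p IH] i /=.
  move=> _ ->; exists 0 => // x; by rewrite subrr expr0n mul0r.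
move=> /andP[aik pk] jE.
rewrite (_ : (fun _ => _) = fun x => (x i - x k) + (x k - x j)).
  by apply: dominatedD; [exact: dominated_edge|exact: IH].
by apply/funext => x; rewrite subrKA.
Qed.

Lemma laplacian_sum0 x : \sum_i laplacian x i = 0.
Proof.
under eq_bigr do rewrite -[laplacian x _]mul1r.
rewrite (laplacian_sym x (fun=> 1)) big1// => i _.
by rewrite /laplacian big1 ?mulr0// => j _; rewrite subrr.
Qed.

(* Summation against a constant vanishes, so x may be replaced by x - x i0; then
   2 u v <= a u^2 + v^2 / a with a small absorbs the left-hand side. *)
Lemma dirichlet_le (i0 : 'I_N) :
  exists2 K, 0 <= K & forall x, dirichlet x <= K * \sum_i laplacian x i ^+ 2.
Proof.
have [C C0 HC] := dominated_sum_sqr (fun i => @ler01 R)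
  (fun i => poincare i i0).
(* Here a = 1 / (C + 1), where [C] may be 0. The term with u^2 is then at most one copy of
   [dirichlet x]. *)
exists (C + 1) => [|x]; first by rewrite addr_ge0.
have {}HC := HC x; rewrite (eq_bigr (fun i => (x i - x i0) ^+ 2)) in HC; last first.
  by move=> i _; rewrite mul1r.
have CP : 0 < C + 1 by rewrite ltr_wpDl.
have E : dirichlet x = \sum_i (x i - x i0) * laplacian x i.
  under [RHS]eq_bigr do rewrite mulrBl.
  by rewrite sumrB -mulr_sumr laplacian_sum0 mulr0 subr0.
have le2 : 2 * dirichlet x <= (C + 1)^-1 * (\sum_i (x i - x i0) ^+ 2) +
    (C + 1) * \sum_i laplacian x i ^+ 2.
  rewrite E !mulr_sumr -big_split; apply: ler_sum => i _ /=.
  set u := x i - x i0; set v := laplacian x i.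
  rewrite -subr_ge0 (_ : _ - _ = (C + 1)^-1 * (u - (C + 1) * v) ^+ 2).
    by rewrite mulr_ge0 ?sqr_ge0// invr_ge0 ltW.
  by field; rewrite gt_eqF.
have : (C + 1)^-1 * (\sum_i (x i - x i0) ^+ 2) <= dirichlet x.
  rewrite mulrC ler_pdivrMr//; apply: le_trans HC _.
  by rewrite mulrC ler_wpM2l ?dirichlet_ge0 ?lerDl.
lra.
Qed.

End Laplacian.

(** * Lyapunov function *)

Section Lyapunov.
Context {R : realType} {N : nat} (adj : rel 'I_N) (gamma k1 k2 : 'I_N -> R).
Hypothesis adj_sym : symmetric adj.
Hypothesis adj_conn : connected_graph adj.
Hypothesis gamma_gt0 : forall i, 0 < gamma i.
Hypothesis k1_itv : forall i, 0 < k1 i < 1.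
Hypothesis k2E : forall i, k2 i = 1 - k1 i ^+ 2.

(* One planar coordinate of the deviation (Q, eta, omega) from an equilibrium. *)
Definition coords := (('I_N -> R) * ('I_N -> R) * ('I_N -> R))%type.
Implicit Type s : coords.

Definition tracking s i := s.1.1 i - s.1.2 i.

(** For symmetric [adj], this is [gamma i] times the partial derivative of [lyapunov] with respect
    to eta_i. *)
Definition gradient s i := gamma i * laplacian adj s.1.2 i - tracking s i.

Definition lyapunov s :=
  2^-1 * (dirichlet adj s.1.2 +
          \sum_i (gamma i)^-1 * (tracking s i ^+ 2 + s.2 i ^+ 2)).

Definition dissipation s :=
  \sum_i (gamma i)^-1 *
    (gradient s i ^+ 2 + tracking s i ^+ 2 + k2 i * s.2 i ^+ 2).

Definition momentum s :=
  \sum_i (gamma i)^-1 * (s.1.1 i + k2 i * s.1.2 i - k1 i * s.2 i).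

Let k2_gt0 i : 0 < k2 i.
Proof.
have /andP[k0 kl1] := k1_itv i.
by rewrite k2E subr_gt0 expr_lt1// ltW.
Qed.

Let k2_ge0 i : 0 <= k2 i. Proof. exact: ltW. Qed.

Let igamma_ge0 i : 0 <= (gamma i)^-1. Proof. by rewrite invr_ge0 ltW. Qed.

Lemma lyapunov_ge0 s : 0 <= lyapunov s.
Proof.
rewrite mulr_ge0 ?invr_ge0// addr_ge0 ?dirichlet_ge0//.
by apply: sumr_ge0 => i _; rewrite mulr_ge0 ?addr_ge0 ?sqr_ge0.
Qed.

Let dissipation_term i s :
  (gamma i)^-1 * (gradient s i ^+ 2 + tracking s i ^+ 2 + k2 i * s.2 i ^+ 2)
  <= dissipation s.
Proof.
rewrite /dissipation (bigD1 i)//= lerDl; apply: sumr_ge0 => j _.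
by rewrite mulr_ge0// !addr_ge0 ?sqr_ge0// mulr_ge0 ?sqr_ge0.
Qed.

Lemma lyapunov_le_dissipation (i0 : 'I_N) :
  exists2 K, 0 < K & forall s, lyapunov s <= K * dissipation s.
Proof.
have dom_e i : dominated dissipation (fun s => tracking s i).
  exists (gamma i) => [|s]; first exact: ltW.
  rewrite -ler_pdivrMl//; apply: le_trans (dissipation_term i s).
  by rewrite ler_wpM2l// addrAC lerDr addr_ge0 ?sqr_ge0// mulr_ge0 ?sqr_ge0.
have dom_g i : dominated dissipation (fun s => gradient s i).
  exists (gamma i) => [|s]; first exact: ltW.
  rewrite -ler_pdivrMl//; apply: le_trans (dissipation_term i s).
  by rewrite ler_wpM2l// -addrA lerDl addr_ge0 ?sqr_ge0// mulr_ge0 ?sqr_ge0.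
(* Control of omega comes from k2 > 0, that is, from 0 < k1 < 1. *)
have dom_w i : dominated dissipation (fun s => s.2 i).
  exists ((k2 i)^-1 * gamma i) => [|s].
    by rewrite mulr_ge0 ?invr_ge0 ?ltW.
  rewrite -mulrA -ler_pdivrMl ?invr_gt0// invrK -ler_pdivrMl//.
  apply: le_trans (dissipation_term i s).
  by rewrite ler_wpM2l// lerDr addr_ge0 ?sqr_ge0.
have dom_L i : dominated dissipation (fun s => laplacian adj s.1.2 i).
  rewrite (_ : (fun _ => _) = fun s => (gamma i)^-1 * (gradient s i + tracking s i)).
    exact/dominatedZ/dominatedD.
  by apply/funext => s; rewrite /gradient subrK mulKf// gt_eqF.
have [C C0 HC] := dominated_sum_sqr igamma_ge0 dom_e.
have [C' C'0 HC'] := dominated_sum_sqr igamma_ge0 dom_w.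
have [D D0 HD] := dominated_sum_sqr (fun i => @ler01 R) dom_L.
have [E E0 HE] := dirichlet_le (R := R) adj_sym adj_conn i0.
(* The summand 1 makes the constant positive: its inverse becomes the decay rate. *)
exists (2^-1 * (E * D + C + C' + 1)) => [|s].
  by rewrite mulr_gt0 ?invr_gt0// ltr_wpDl// !addr_ge0 ?mulr_ge0.
have diss_ge0 : 0 <= dissipation s.
  apply: sumr_ge0 => j _.
  by rewrite mulr_ge0// !addr_ge0 ?sqr_ge0// mulr_ge0 ?sqr_ge0.
rewrite /lyapunov -mulrA ler_wpM2l ?invr_ge0//.
under [X in _ + X <= _]eq_bigr do rewrite mulrDr.
rewrite big_split/= !mulrDl.
have := HC s; have := HC' s; have := HE s.1.2.
have : E * (\sum_i laplacian adj s.1.2 i ^+ 2) <= E * D * dissipation s.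
  rewrite -mulrA ler_wpM2l//; apply: le_trans (HD s).
  by apply: ler_sum => i _; rewrite mul1r.
lra.
Qed.

(** [lyapunov] vanishes exactly when Q = eta is a constant vector and omega = 0. The momentum of
    such a state is a positive multiple of the constant, so zero momentum excludes this
    direction. *)
Lemma norm_le_lyapunov (i0 : 'I_N) :
  exists2 K, 0 <= K & forall s, momentum s = 0 ->
    \sum_i (s.1.1 i ^+ 2 + s.1.2 i ^+ 2 + s.2 i ^+ 2) <= K * lyapunov s.
Proof.
have V_ge i s : (gamma i)^-1 * (tracking s i ^+ 2 + s.2 i ^+ 2) <= 2 * lyapunov s.
  rewrite /lyapunov mulVKf// (bigD1 i)//= addrCA lerDl addr_ge0 ?dirichlet_ge0//.
  by apply: sumr_ge0 => j _; rewrite mulr_ge0 ?addr_ge0 ?sqr_ge0.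
have dom_e i : dominated lyapunov (fun s => tracking s i).
  exists (gamma i * 2) => [|s]; first by rewrite mulr_ge0 ?ltW.
  rewrite -mulrA -ler_pdivrMl//; apply: le_trans (V_ge i s).
  by rewrite ler_wpM2l// lerDl sqr_ge0.
have dom_w i : dominated lyapunov (fun s => s.2 i).
  exists (gamma i * 2) => [|s]; first by rewrite mulr_ge0 ?ltW.
  rewrite -mulrA -ler_pdivrMl//; apply: le_trans (V_ge i s).
  by rewrite ler_wpM2l// lerDr sqr_ge0.
have dom_d i j : dominated lyapunov (fun s => s.1.2 i - s.1.2 j).
  have [C C0 HC] := poincare adj_sym adj_conn i j (R := R).
  exists (C * 2) => [|s]; first by rewrite mulr_ge0.
  apply: le_trans (HC _) _; rewrite -mulrA ler_wpM2l// /lyapunov mulVKf// lerDl.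
  by apply: sumr_ge0 => k _; rewrite mulr_ge0 ?addr_ge0 ?sqr_ge0.
(* Adding a constant a to all entries of Q and eta raises the momentum by a times the sum of the
   [p j]. *)
pose p j := (gamma j)^-1 * (1 + k2 j).
have p_gt0 j : 0 < p j by rewrite mulr_gt0 ?invr_gt0 ?addr_gt0.
have P_gt0 : 0 < \sum_j p j.
  rewrite (bigD1 i0)//= ltr_pwDl//; apply: sumr_ge0 => j _; exact: ltW.
(* This correction is invariant under common shifts of Q and eta, hence expressible through
   differences of eta, tracking errors and omega. It equals eta when the momentum is zero. *)
pose eta' s i := s.1.2 i - (\sum_j p j)^-1 * momentum s.
have dom_eta i : dominated lyapunov (fun s => eta' s i).
  rewrite (_ : (fun _ => _) = fun s => (\sum_j p j)^-1 *
     \sum_j (p j * (s.1.2 i - s.1.2 j) +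
       (- (gamma j)^-1 * tracking s j + (gamma j)^-1 * k1 j * s.2 j))).
    apply/dominatedZ/dominated_sum => j.
    by do !apply: dominatedD; exact: dominatedZ.
  apply/funext => s; rewrite /eta'; apply: (@mulfI _ (\sum_j p j)).
    by rewrite gt_eqF.
  rewrite mulVKf ?gt_eqF// mulrBr mulVKf ?gt_eqF// mulr_suml /momentum -sumrB.
  by apply: eq_bigr => j _; rewrite /p /tracking; ring.
have dom_q i : dominated lyapunov (fun s => tracking s i + eta' s i).
  exact: dominatedD.
have [A A0 HA] := dominated_sum_sqr (fun i => @ler01 R) dom_q.
have [B B0 HB] := dominated_sum_sqr (fun i => @ler01 R) dom_eta.
have [C C0 HC] := dominated_sum_sqr (fun i => @ler01 R) dom_w.
exists (A + B + C) => [|s s0]; first by rewrite !addr_ge0.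
rewrite !mulrDl !big_split/= !lerD//.
- apply: le_trans (HA s); apply: ler_sum => i _.
  by rewrite /eta' s0 mulr0 subr0 /tracking subrK mul1r.
- by apply: le_trans (HB s); apply: ler_sum => i _; rewrite /eta' s0 mulr0 subr0 mul1r.
- by apply: le_trans (HC s); apply: ler_sum => i _; rewrite mul1r.
Qed.

End Lyapunov.

(** * Decay along the flow *)

Section Analysis.
Context {R : realType}.

Lemma is_derive_sumf (I : Type) (r : seq I) (P : pred I) (h : I -> R -> R)
    (dh : I -> R) (t : R) :
  (forall i, P i -> is_derive t 1 (h i) (dh i)) ->
  is_derive t 1 (fun s => \sum_(i <- r | P i) h i s) (\sum_(i <- r | P i) dh i).
Proof.
move=> dh_i; elim: r => [|i r IH].
  rewrite big_nil; under eq_fun do rewrite big_nil; exact: is_derive_cst.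
rewrite big_cons; under eq_fun do rewrite big_cons.
by case: ifP => // Pi; exact: (is_deriveD (dh_i i Pi) IH).
Qed.

Lemma within_continuousM {U : topologicalType} (A : set U) (f g : U -> R) :
  {within A, continuous f} -> {within A, continuous g} ->
  {within A, continuous (fun x => f x * g x)}.
Proof. by move=> cf cg x; apply: cvgM; [exact: cf|exact: cg]. Qed.

Lemma within_continuousDf {U : topologicalType} (A : set U) (f g : U -> R) :
  {within A, continuous f} -> {within A, continuous g} ->
  {within A, continuous (fun x => f x + g x)}.
Proof. by move=> cf cg x; apply: cvgD; [exact: cf|exact: cg]. Qed.

Lemma within_continuousBf {U : topologicalType} (A : set U) (f g : U -> R) :
  {within A, continuous f} -> {within A, continuous g} ->
  {within A, continuous (fun x => f x - g x)}.
Proof. by move=> cf cg x; apply: cvgB; [exact: cf|exact: cg]. Qed.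

Lemma within_continuous_sum {U : topologicalType} (A : set U) (I : Type)
    (r : seq I) (P : pred I) (f : I -> U -> R) :
  (forall i, P i -> {within A, continuous (f i)}) ->
  {within A, continuous (fun x => \sum_(i <- r | P i) f i x)}.
Proof. by move=> cf x; apply: (cvg_big add_continuous) => i Pi; exact: cf. Qed.

(** Grönwall's argument: the product of [f] with the integrating factor exp(a t) is nonincreasing.
    Continuity carries the estimate down to time 0. The case a = 0 serves for the momentum. *)
Lemma exponential_decay (f df : R -> R) (a : R) :
  {within `[0, +oo[, continuous f} ->
  (forall t : R, 0 < t -> is_derive t 1 f (df t)) ->
  (forall t, 0 < t -> df t <= - a * f t) ->
  forall t, 0 <= t -> f t <= f 0 * expR (- (a * t)).
Proof.
move=> cf Df dfle t t0.
pose g s := f s * expR (a * s).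
have De (s : R) : is_derive s 1 (fun s => expR (a * s)) (a * expR (a * s)).
  rewrite mulrC; apply: (is_derive1_comp (f := expR) (g := fun s => a * s)).
  by rewrite -[X in is_derive _ _ _ X]mulr1; exact: is_deriveZ.
have Dg (s : R) : 0 < s ->
    is_derive s 1 g (f s * (a * expR (a * s)) + expR (a * s) * df s).
  by move=> s0; apply: is_deriveM; exact: Df.
have : g t <= g 0.
  apply: (@ler0_derive1_nincry _ _ 0) => //.
  - by move=> s; rewrite in_itv/= andbT => /Dg[].
  - move=> s; rewrite in_itv/= andbT => s0; have [_] := Dg s s0.
    rewrite derive1E => ->; rewrite mulrA -[f s * a * _]mulrC -mulrDr.
    rewrite pmulr_rle0 ?expR_gt0//; have := dfle s s0; lra.
  - apply: within_continuousM; first exact: cf.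
    apply: continuous_subspaceT => u.
    by apply: differentiable_continuous; apply/derivable1_diffP; case: (De u).
rewrite /g mulr0 expR0 mulr1 expRN => le_g.
by rewrite ler_pdivlMr ?expR_gt0.
Qed.

End Analysis.

(** * Conservation of the momentum and dissipation of the Lyapunov function *)

Section Flow.
Context {R : realType} {N : nat} (adj : rel 'I_N) (gamma k1 k2 : 'I_N -> R).
Hypothesis adj_sym : symmetric adj.
Hypothesis gamma_gt0 : forall i, 0 < gamma i.
Hypothesis k2E : forall i, k2 i = 1 - k1 i ^+ 2.

Local Notation laplacian := (laplacian adj).
Local Notation gradient := (gradient adj gamma).
Local Notation lyapunov := (lyapunov adj gamma).
Local Notation dissipation := (dissipation adj gamma k2).
Local Notation momentum := (momentum gamma k1 k2).

(** One planar coordinate of the dynamics with zero offsets, with the regularity required by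
    [trajectory]. *)
Definition coords_flow (s : R -> @coords R N) : Prop :=
  (forall i, [/\ {within `[0, +oo[, continuous (fun t => (s t).1.1 i)},
                 {within `[0, +oo[, continuous (fun t => (s t).1.2 i)} &
                 {within `[0, +oo[, continuous (fun t => (s t).2 i)}]) /\
  (forall t : R, 0 < t -> forall i,
    [/\ is_derive t 1 (fun u => (s u).1.1 i) (- tracking (s t) i),
        is_derive t 1 (fun u => (s u).1.2 i)
          (- gradient (s t) i - k1 i * (s t).2 i) &
        is_derive t 1 (fun u => (s u).2 i)
          (k1 i * gradient (s t) i - k2 i * (s t).2 i)]).

Variable s : R -> @coords R N.
Hypothesis s_flow : coords_flow s.

Let cq i : {within `[0, +oo[, continuous (fun t => (s t).1.1 i)}.
Proof. by case: (s_flow.1 i). Qed.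
Let ce i : {within `[0, +oo[, continuous (fun t => (s t).1.2 i)}.
Proof. by case: (s_flow.1 i). Qed.
Let cw i : {within `[0, +oo[, continuous (fun t => (s t).2 i)}.
Proof. by case: (s_flow.1 i). Qed.
Let ccst (c : R) : {within `[0 : R, +oo[, continuous (fun=> c)}.
Proof. by apply: continuous_subspaceT => x; exact: cvg_cst. Qed.

Lemma within_continuous_lyapunov :
  {within `[0, +oo[, continuous (fun t => lyapunov (s t))}.
Proof.
apply: within_continuousM; first exact: ccst.
apply: within_continuousDf; apply: within_continuous_sum => i _.
  apply: within_continuousM; first exact: ce.
  by apply: within_continuous_sum => j _; exact: within_continuousBf.
apply: within_continuousM; first exact: ccst.
apply: within_continuousDf; last exact: (within_continuousM (@cw i) (@cw i)).
have ct : {within `[0, +oo[, continuous (fun t => tracking (s t) i)}.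
  exact: within_continuousBf.
exact: (within_continuousM ct ct).
Qed.

Lemma within_continuous_momentum :
  {within `[0, +oo[, continuous (fun t => momentum (s t))}.
Proof.
apply: within_continuous_sum => i _.
apply: within_continuousM; first exact: ccst.
apply: within_continuousBf; last by apply: within_continuousM; [exact: ccst|exact: cw].
by apply: within_continuousDf; [exact: cq|apply: within_continuousM; [exact: ccst|exact: ce]].
Qed.

(** The omega terms cancel and k2 + k1^2 = 1 leaves -(g + e) / gamma = - L eta, whose entries sum to
    0. *)
Lemma is_derive_momentum (t : R) : 0 < t ->
  is_derive t 1 (fun u => momentum (s u)) 0.
Proof.
move=> t0; have Ds := s_flow.2 t t0.
have -> : 0 = \sum_i (gamma i)^-1 * (- tracking (s t) i +
    k2 i * (- gradient (s t) i - k1 i * (s t).2 i) -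
    k1 i * (k1 i * gradient (s t) i - k2 i * (s t).2 i)).
  rewrite -[LHS]oppr0 -[X in - X](laplacian_sum0 adj_sym (s t).1.2) -sumrN.
  apply: eq_bigr => i _; rewrite k2E /gradient; field.
  by rewrite gt_eqF.
apply: is_derive_sumf => i _; have [Dq De Dw] := Ds i.
by apply: is_deriveZ; apply: is_deriveB.
Qed.

(** Symmetry of L and L eta = (g + e) / gamma give the integrand (g eta' - e^2 + omega omega') /
    gamma. The cross terms k1 g omega from the eta and omega equations then cancel. *)
Lemma is_derive_lyapunov (t : R) : 0 < t ->
  is_derive t 1 (fun u => lyapunov (s u)) (- dissipation (s t)).
Proof.
move=> t0; have Ds := s_flow.2 t t0.
pose de i := - gradient (s t) i - k1 i * (s t).2 i.
pose dw i := k1 i * gradient (s t) i - k2 i * (s t).2 i.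
have De i : is_derive t 1 (fun u => (s u).1.2 i) (de i) by case: (Ds i).
have Dw i : is_derive t 1 (fun u => (s u).2 i) (dw i) by case: (Ds i).
have Dt i : is_derive t 1 (fun u => tracking (s u) i) (- tracking (s t) i - de i).
  by apply: is_deriveB; case: (Ds i).
have DL i : is_derive t 1 (fun u => laplacian (s u).1.2 i) (laplacian de i).
  by apply: is_derive_sumf => j _; exact: is_deriveB.
have sqr (f : R -> R) (df : R) : is_derive t 1 f df ->
    is_derive t 1 (fun u => f u ^+ 2) (2 * (f t * df)).
  by move=> Df; rewrite mulr2n mulrDl mul1r; exact: (is_deriveM Df Df).
have -> : - dissipation (s t) = 2^-1 *
   ((\sum_i ((s t).1.2 i * laplacian de i + laplacian (s t).1.2 i * de i)) +
    \sum_i (gamma i)^-1 * (2 * (tracking (s t) i * (- tracking (s t) i - de i)) +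
     2 * ((s t).2 i * dw i))).
  rewrite big_split/= (laplacian_sym adj_sym) -!big_split/= mulr_sumr -sumrN.
  apply: eq_bigr => i _.
  have -> : laplacian (s t).1.2 i = (gamma i)^-1 * (gradient (s t) i + tracking (s t) i).
    by rewrite /gradient subrK mulKf// gt_eqF.
  by rewrite /de /dw; field; rewrite gt_eqF.
apply: is_deriveZ; apply: is_deriveD; apply: is_derive_sumf => i _.
exact: (is_deriveM (De i) (DL i)).
Qed.

End Flow.

(** The constants are chosen before the flow, so that the rate does not depend on the initial
    state. *)
Lemma coords_flow_decay (R : realType) (N : nat) (i0 : 'I_N) (adj : rel 'I_N)
    (gamma k1 k2 : 'I_N -> R) :
  symmetric adj -> connected_graph adj -> (forall i, 0 < gamma i) ->
  (forall i, 0 < k1 i < 1) -> (forall i, k2 i = 1 - k1 i ^+ 2) ->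
  exists K lambda : R, [/\ 0 <= K, 0 < lambda &
    forall s : R -> coords, coords_flow adj gamma k1 k2 s ->
    momentum gamma k1 k2 (s 0) = 0 -> forall t, 0 <= t ->
    \sum_i ((s t).1.1 i ^+ 2 + (s t).1.2 i ^+ 2 + (s t).2 i ^+ 2) <=
    K * lyapunov adj gamma (s 0) * expR (- (lambda * t))].
Proof.
move=> adj_sym adj_conn gamma_gt0 k1_itv k2E.
have [C C0 HC] := lyapunov_le_dissipation adj_sym adj_conn gamma_gt0 k1_itv k2E i0.
have [K K0 HK] := norm_le_lyapunov adj_sym adj_conn gamma_gt0 k1_itv k2E i0.
exists K, C^-1; split; rewrite ?invr_gt0// => s s_flow s0 t t0.
(* Decay with rate 0, used for a = 1 and a = -1, keeps the momentum equal to 0. *)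
have mom_le (a : R) (u : R) : 0 <= u -> a * momentum gamma k1 k2 (s u) <= 0.
  move=> u0; rewrite -[leRHS](mul0r (expR (- (0 * u)))).
  rewrite -[X in _ <= X * _](mulr0 a) -[X in _ <= a * X * _]s0.
  apply: (@exponential_decay R (fun u => a * momentum gamma k1 k2 (s u)) (fun=> a * 0))
    => // [|v v0|v v0].
  - apply: within_continuousM; last exact: (within_continuous_momentum s_flow).
    by apply: continuous_subspaceT => x; exact: cvg_cst.
  - by have := is_derive_momentum adj_sym gamma_gt0 k2E s_flow v0; exact: is_deriveZ.
  - by rewrite oppr0 mul0r mulr0.
have mom0 u : 0 <= u -> momentum gamma k1 k2 (s u) = 0.
  by move=> u0; have := mom_le 1 u u0; have := mom_le (-1) u u0; lra.
apply: le_trans (HK _ (mom0 t t0)) _; rewrite -mulrA ler_wpM2l//.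
apply: (@exponential_decay R
  (fun u => lyapunov adj gamma (s u)) (fun u => - dissipation adj gamma k2 (s u)))
  => //.
- exact: (within_continuous_lyapunov s_flow).
- by move=> u u0; exact: (is_derive_lyapunov adj_sym gamma_gt0 s_flow).
- move=> u u0; rewrite mulNr lerN2 ler_pdivrMl//; exact: HC.
Qed.

(** * Stacked states *)

Section States.
Context {R : realType} {N : nat} (adj : rel 'I_N) (gamma k1 k2 : 'I_N -> R).
Implicit Types (X Y : state R N) (delta : 'I_N -> 'rV[R]_2).

Lemma pos_entry X i k : pos X i k = X (lshift _ i) k.
Proof. by rewrite mxE. Qed.

Lemma est_entry X i k : est X i k = X (rshift _ (lshift _ i)) k.
Proof. by rewrite !mxE. Qed.

Lemma aux_entry X i k : aux X i k = X (rshift _ (rshift _ i)) k.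
Proof. by rewrite !mxE. Qed.

Lemma state_eq X Y :
  (forall i k, pos X i k = pos Y i k) -> (forall i k, est X i k = est Y i k) ->
  (forall i k, aux X i k = aux Y i k) -> X = Y.
Proof.
move=> eq_pos eq_est eq_aux; rewrite -[X]vsubmxK -[Y]vsubmxK.
rewrite -[dsubmx X]vsubmxK -[dsubmx Y]vsubmxK.
by congr col_mx; [|congr col_mx]; apply/matrixP.
Qed.

Definition coords_of (k : 'I_2) X : @coords R N :=
  (fun i => pos X i k, fun i => est X i k, fun i => aux X i k).

Lemma disagreementE X i k :
  disagreement adj X i 0 k = laplacian adj (fun i => est X i k) i.
Proof. by rewrite summxE; apply: eq_bigr => j _; rewrite !mxE. Qed.

Lemma pos_dynamics delta X i k :
  pos (dynamics adj delta gamma k1 k2 X) i k =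
  - (pos X i k - est X i k - delta i 0 k).
Proof. by rewrite /pos col_mxKu !mxE. Qed.

Lemma est_dynamics delta X i k :
  est (dynamics adj delta gamma k1 k2 X) i k =
  - (gamma i * laplacian adj (fun i => est X i k) i) +
  (pos X i k - est X i k - delta i 0 k) - k1 i * aux X i k.
Proof.
by rewrite -disagreementE {1}/est col_mxKd col_mxKu /tracking_error !mxE.
Qed.

Lemma aux_dynamics delta X i k :
  aux (dynamics adj delta gamma k1 k2 X) i k =
  k1 i * (gamma i * laplacian adj (fun i => est X i k) i -
    (pos X i k - est X i k - delta i 0 k)) - k2 i * aux X i k.
Proof.
by rewrite -disagreementE {1}/aux !col_mxKd /tracking_error !mxE.
Qed.

Lemma laplacianZD (a : R) (x y : 'I_N -> R) i :
  laplacian adj (fun i => a * x i + y i) i = a * laplacian adj x i + laplacian adj y i.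
Proof.
by rewrite mulr_sumr -big_split; apply: eq_bigr => j _ /=; ring.
Qed.

Lemma pos_linear (a : R) X Y i k : pos (a *: X + Y) i k = a * pos X i k + pos Y i k.
Proof. by rewrite !mxE. Qed.

Lemma est_linear (a : R) X Y i k : est (a *: X + Y) i k = a * est X i k + est Y i k.
Proof. by rewrite !mxE. Qed.

Lemma aux_linear (a : R) X Y i k : aux (a *: X + Y) i k = a * aux X i k + aux Y i k.
Proof. by rewrite !mxE. Qed.

(** The offsets enter as an additive constant, so the linear part is the dynamics with zero offsets;
    taking [delta] zero gives its linearity. *)
Lemma dynamics_affine delta (a : R) X Y :
  dynamics adj delta gamma k1 k2 (a *: X + Y) =
  a *: dynamics adj (fun=> 0) gamma k1 k2 X + dynamics adj delta gamma k1 k2 Y.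
Proof.
have zero_entry k : (0 : 'rV[R]_2) 0 k = 0 by rewrite mxE.
apply: state_eq => i k; rewrite ?(pos_linear, est_linear, aux_linear).
- by rewrite !pos_dynamics !(pos_linear, est_linear) zero_entry; ring.
- rewrite !est_dynamics !(pos_linear, est_linear, aux_linear).
  under [fun i => _]eq_fun do rewrite est_linear.
  by rewrite laplacianZD zero_entry; ring.
- rewrite !aux_dynamics !(pos_linear, est_linear, aux_linear).
  under [fun i => _]eq_fun do rewrite est_linear.
  by rewrite laplacianZD zero_entry; ring.
Qed.

Lemma dynamicsD delta X Y :
  dynamics adj delta gamma k1 k2 (X + Y) =
  dynamics adj (fun=> 0) gamma k1 k2 X + dynamics adj delta gamma k1 k2 Y.
Proof. by rewrite -[X in LHS]scale1r dynamics_affine scale1r. Qed.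

Lemma sum_sqr_coords X :
  \sum_i \sum_j X i j ^+ 2 =
  \sum_k \sum_i ((coords_of k X).1.1 i ^+ 2 + (coords_of k X).1.2 i ^+ 2 +
                 (coords_of k X).2 i ^+ 2).
Proof.
rewrite exchange_big; apply: eq_bigr => k _ /=.
rewrite !big_split_ord/= !big_split/= addrA.
by congr (_ + _ + _); apply: eq_bigr => i _; rewrite !mxE.
Qed.

(** The estimates agree on [c], which is the centroid of the positions when the offsets sum to 0. *)
Definition steady_state delta (c : 'rV[R]_2) : state R N :=
  col_mx (\matrix_i (c + delta i)) (col_mx (\matrix_i c) 0).

Lemma steady_state_equilibrium delta c :
  equilibrium (dynamics adj delta gamma k1 k2) (steady_state delta c).
Proof.
have posE i k : pos (steady_state delta c) i k = c 0 k + delta i 0 k.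
  by rewrite /pos col_mxKu !mxE.
have estE i k : est (steady_state delta c) i k = c 0 k.
  by rewrite /est col_mxKd col_mxKu !mxE.
have auxE i k : aux (steady_state delta c) i k = 0.
  by rewrite /aux !col_mxKd !mxE.
have lap0 i k : laplacian adj (fun i => est (steady_state delta c) i k) i = 0.
  by apply: big1 => j _; rewrite !estE subrr.
apply: state_eq => i k; rewrite ?(pos_dynamics, est_dynamics, aux_dynamics);
  rewrite ?lap0 ?posE ?estE ?auxE !mxE; ring.
Qed.

(** Every agent already has cost 0, the least possible value of a squared norm. *)
Lemma steady_state_optimal delta c : \sum_i delta i = 0 ->
  formation_optimal delta (pos (steady_state delta c)).
Proof.
move=> delta0 i q; rewrite /cost.
have rowE j : row j (pos (steady_state delta c)) = c + delta j.
  by apply/rowP => k; rewrite /pos col_mxKu !mxE.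
rewrite {1}/centroid; under eq_bigr do rewrite rowE.
rewrite big_split/= delta0 addr0 sumr_const card_ord rowE.
have N0 : N%:R != 0 :> R by rewrite pnatr_eq0 -lt0n (leq_ltn_trans _ (ltn_ord i)).
rewrite -[c *+ N]scaler_nat scalerA mulVf// scale1r [c + _]addrC addrK subrr.
rewrite [X in X ^+ 2](_ : _ = 0).
  by rewrite expr0n mulr0 mulr_ge0 ?invr_ge0 ?sqr_ge0.
rewrite /enorm big1 ?sqrtr0// => a _; apply: big1 => b _.
by rewrite mxE expr0n.
Qed.

End States.

(** * Deviation from an equilibrium *)

Section Deviation.
Context {R : realType} {N : nat} (adj : rel 'I_N) (gamma k1 k2 : 'I_N -> R).
Variables (delta : 'I_N -> 'rV[R]_2) (Xstar : state R N).

Let F := dynamics adj delta gamma k1 k2.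

Hypothesis Xstar_eq : equilibrium F Xstar.

(** Subtracting an equilibrium removes the offsets by [dynamicsD], and the two planar coordinates
    decouple. *)
Lemma deviation_flow (X : R -> state R N) (k : 'I_2) :
  trajectory F X ->
  coords_flow adj gamma k1 k2 (fun t => coords_of k (X t - Xstar)).
Proof.
move=> [cX dX].
have c_entry a : {within `[0, +oo[, continuous (fun t => (X t - Xstar) a k)}.
  rewrite (_ : (fun _ => _) = fun t => X t a k - Xstar a k); last first.
    by apply/funext => t; rewrite !mxE.
  apply: within_continuousBf; last by apply: continuous_subspaceT => x; exact: cvg_cst.
  apply: (@within_continuous_comp _ _ _ _ X (fun M : state R N => M a k)) cX.
  by move=> M _; exact: coord_continuous.
have d_entry (t : R) a : 0 < t -> is_derive t 1 (fun u => (X u - Xstar) a k)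
    (dynamics adj (fun=> 0) gamma k1 k2 (X t - Xstar) a k).
  move=> t0; have /is_derive_mxP/(_ a k) dXak := dX t t0.
  have -> : dynamics adj (fun=> 0) gamma k1 k2 (X t - Xstar) = F (X t).
    have FX : dynamics adj delta gamma k1 k2 Xstar = 0 := Xstar_eq.
    by rewrite -[X t in RHS](subrK Xstar) /F [RHS]dynamicsD FX addr0.
  rewrite (_ : (fun _ => _) = fun u => X u a k - Xstar a k); last first.
    by apply/funext => u; rewrite !mxE.
  by rewrite -[X in is_derive _ _ _ X]subr0; exact: is_deriveB.
have posE i : (fun t => pos (X t - Xstar) i k) = fun t => (X t - Xstar) (lshift _ i) k.
  by apply/funext => t; rewrite pos_entry.
have estE i : (fun t => est (X t - Xstar) i k) =
    fun t => (X t - Xstar) (rshift _ (lshift _ i)) k.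
  by apply/funext => t; rewrite est_entry.
have auxE i : (fun t => aux (X t - Xstar) i k) =
    fun t => (X t - Xstar) (rshift _ (rshift _ i)) k.
  by apply/funext => t; rewrite aux_entry.
have zero_entry : (0 : 'rV[R]_2) 0 k = 0 by rewrite mxE.
split=> [i|t t0 i] /=; rewrite posE estE auxE; split; rewrite ?c_entry//.
- have := d_entry t (lshift _ i) t0.
  by rewrite -pos_entry pos_dynamics zero_entry subr0.
- have := d_entry t (rshift _ (lshift _ i)) t0.
  rewrite -est_entry est_dynamics zero_entry subr0 /gradient /tracking /=.
  by rewrite opprB [- _ + (_ - _)]addrC.
- have := d_entry t (rshift _ (rshift _ i)) t0.
  by rewrite -aux_entry aux_dynamics zero_entry subr0.
Qed.

End Deviation.

(** * Selection of the limiting equilibrium and convergence *)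

Lemma sum_offset (R : realType) (N : nat) (Qbar : 'M[R]_(N, 2)) :
  (0 < N)%N -> \sum_i offset Qbar i = 0.
Proof.
move=> N_gt0; rewrite sumrB sumr_const card_ord /centroid scalerMnl.
by rewrite -mulr_natl mulfV ?scale1r ?subrr// pnatr_eq0 -lt0n.
Qed.

(* The conserved momentum of the limit must be that of the initial state, and
   (1 + k2) / gamma > 0 makes this an equation determining the limit. *)
Lemma exists_steady_state (R : realType) (N : nat) (gamma k1 k2 : 'I_N -> R)
    (delta : 'I_N -> 'rV[R]_2) (X0 : state R N) :
  (0 < N)%N -> (forall i, 0 < gamma i) -> (forall i, 0 < k1 i < 1) ->
  (forall i, k2 i = 1 - k1 i ^+ 2) ->
  exists c : 'rV[R]_2, forall k,
    momentum gamma k1 k2 (coords_of k (X0 - steady_state delta c)) = 0.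
Proof.
move=> N_gt0 gamma_gt0 k1_itv k2E.
pose P := \sum_i (gamma i)^-1 * (1 + k2 i).
have k2_gt0 i : 0 < k2 i.
  by have /andP[k0 kl1] := k1_itv i; rewrite k2E subr_gt0 expr_lt1// ltW.
have P_neq0 : P != 0.
  rewrite gt_eqF// /P (bigD1 (Ordinal N_gt0))//= ltr_pwDl//.
    by rewrite mulr_gt0 ?invr_gt0 ?addr_gt0.
  by apply: sumr_ge0 => i _; rewrite mulr_ge0 ?invr_ge0 ?addr_ge0 ?ltW.
exists (\row_k (P^-1 * \sum_i (gamma i)^-1 *
  (pos X0 i k - delta i 0 k + k2 i * est X0 i k - k1 i * aux X0 i k))) => k.
set c := \row_k _.
have -> : momentum gamma k1 k2 (coords_of k (X0 - steady_state delta c)) =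
    \sum_i (gamma i)^-1 *
    (pos X0 i k - delta i 0 k + k2 i * est X0 i k - k1 i * aux X0 i k) - P * c 0 k.
  rewrite /P mulr_suml -sumrB; apply: eq_bigr => i _ /=.
  have posE : pos (X0 - steady_state delta c) i k = pos X0 i k - (c 0 k + delta i 0 k).
    by rewrite !pos_entry [LHS]mxE [X in _ + X]mxE col_mxEu !mxE.
  have estE : est (X0 - steady_state delta c) i k = est X0 i k - c 0 k.
    by rewrite !est_entry [LHS]mxE [X in _ + X]mxE col_mxEd col_mxEu [in X in _ - X]mxE mxE.
  have auxE : aux (X0 - steady_state delta c) i k = aux X0 i k.
    by rewrite !aux_entry [LHS]mxE [X in _ + X]mxE !col_mxEd mxE subr0.
  by rewrite posE estE auxE; ring.
by rewrite mxE mulVKf// subrr.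
Qed.

Theorem theorem1 (R : realType) (N : nat) (N_gt0 : (0 < N)%N)
    (adj : rel 'I_N) (Hsimple : simple_graph adj)
    (Hconn : connected_graph adj)
    (Qbar : 'M[R]_(N, 2)) (gamma k1 k2 : 'I_N -> R)
    (Hgamma : forall i, 0 < gamma i)
    (Hk1 : forall i, 0 < k1 i < 1)
    (Hk2 : forall i, k2 i = 1 - k1 i ^+ 2) :
  let delta := offset Qbar in
  let F := dynamics adj delta gamma k1 k2 in
  exists lambda : R, 0 < lambda /\
  forall X0 : state R N,
    (exists X : R -> state R N, trajectory F X /\ X 0 = X0) /\
    exists (Xstar : state R N) (c : R),
      [/\ equilibrium F Xstar,
          formation_optimal delta (pos Xstar),
          0 <= c &
          forall X : R -> state R N, trajectory F X -> X 0 = X0 ->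
          forall t : R, 0 <= t ->
            enorm (X t - Xstar) <= c * expR (- (lambda * t))].
Proof.
move=> delta F; have [adj_sym _] := Hsimple.
have [K [lambda [K0 lambda0 decay]]] :=
  coords_flow_decay (Ordinal N_gt0) adj_sym Hconn Hgamma Hk1 Hk2.
(* [decay] bounds the squared norm; the square root halves the rate. *)
exists (lambda / 2); split; first exact: divr_gt0.
move=> X0; have [c mom0] := exists_steady_state delta X0 N_gt0 Hgamma Hk1 Hk2.
pose Xs := steady_state delta c.
have Xs_eq : equilibrium F Xs := steady_state_equilibrium adj gamma k1 k2 delta c.
split.
  (* Existence: the linear equation is solved from [X0 - Xs], and [Xs] is added back. *)
  pose F0 := dynamics adj (fun=> 0) gamma k1 k2.
  have F0_lin : linear F0 := dynamics_affine adj gamma k1 k2 (fun=> 0).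
  pose F0L : {linear state R N -> state R N} :=
    HB.pack F0 (GRing.isLinear.Build _ _ _ _ _ F0_lin).
  have [Y [Y0 dY]] := linear_ode_solution F0L (X0 - Xs).
  have dX (t : R) : is_derive t 1 (fun u => Y u + Xs) (F (Y t + Xs)).
    have FXs : dynamics adj delta gamma k1 k2 Xs = 0 := Xs_eq.
    rewrite /F dynamicsD FXs; have dYt := dY t; exact: is_deriveD.
  exists (fun t => Y t + Xs); split; last by rewrite Y0 subrK.
  split=> [|t _]; last exact: dX.
  apply: continuous_subspaceT => t; apply: differentiable_continuous.
  by apply/derivable1_diffP; case: (dX t).
pose V k := lyapunov adj gamma (coords_of k (X0 - Xs)).
(* The constant collects the initial Lyapunov values of both planar coordinates. *)
exists Xs, (Num.sqrt (\sum_k K * V k)); split => //.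
  exact/steady_state_optimal/sum_offset.
move=> X X_traj X_0 t t0.
have -> : expR (- (lambda / 2 * t)) = Num.sqrt (expR (- (lambda * t))).
  rewrite (_ : - (lambda * t) = - (lambda / 2 * t) + - (lambda / 2 * t)); last by field.
  by rewrite expRD -expr2 sqrtr_sqr ger0_norm ?expR_ge0.
rewrite /enorm -sqrtrM; last first.
  by apply: sumr_ge0 => k _; rewrite mulr_ge0// lyapunov_ge0.
rewrite ler_wsqrtr// sum_sqr_coords mulr_suml; apply: ler_sum => k _.
have := decay _ (deviation_flow Xs_eq k X_traj); rewrite X_0 => /(_ (mom0 k) t t0).
exact.
Qed.
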